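(* Let $H$ be a separable infinite dimensional complex Hilbert space and let $\{x_k\}_{k\in\mathbb{Z}}$ be a frame for $H$. The canonical dual of $\{x_k\}_{k\in\mathbb{Z}}$ is phase retrieval if and only if $\{x_k\}_{k\in\mathbb{Z}}$ is phase retrieval.
   Context: A sequence $\{x_k\}_{k\in\mathbb{Z}}$ in $H$ is a frame for $H$ if there exist constants $0<A\le B$ such that $A\|x\|^2\le\sum_{k\in\mathbb{Z}}|\langle x,x_k\rangle|^2\le B\|x\|^2$ for all $x\in H$. Its frame operator is $S:H\to H$, $S(x)=\sum_{k\in\mathbb{Z}}\langle x,x_k\rangle x_k$, which is bounded, positive and invertible; the canonical dual of $\{x_k\}_{k\in\mathbb{Z}}$ is the sequence $\{S^{-1}x_k\}_{k\in\mathbb{Z}}$. A sequence $\{x_k\}_{k\in\mathbb{Z}}$ in $H$ is phase retrieval if for every $x,y\in H$ with $|\langle x,x_k\rangle|=|\langle y,x_k\rangle|$ for all $k\in\mathbb{Z}$, there exists $\alpha\in\mathbb{C}$ with $|\alpha|=1$ and $x=\alpha y$. *)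

(* Defs.v *)
From HB Require Import structures.
From mathcomp Require Import all_boot all_order all_algebra.
From mathcomp Require Import sesquilinear complex.
From mathcomp Require Import all_classical all_reals all_analysis.
From mathcomp.analysis.showcase Require Import summability.

Set Implicit Arguments.
Unset Strict Implicit.
Unset Printing Implicit Defensive.

Import Order.TTheory GRing.Theory Num.Theory Num.Def.
Import numFieldNormedType.Exports.

Local Open Scope classical_set_scope.
Local Open Scope ring_scope.

(* A complex Hilbert space is given by a complete normed space [H] over [R[i]]
   together with a positive definite Hermitian form [dot : {dot H for conjC}],
   linear in its first argument and conjugate-linear in its second one, that
   induces the norm of [H]. *)
Definition induces_norm (R : realType) (H : completeNormedModType R[i])
    (dot : {dot H for conjC}) : Prop :=
  forall u : H, `|u| ^+ 2 = dot u u.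

Definition separable_space (T : topologicalType) : Prop :=
  exists D : set T, countable D /\ dense D.

Definition infinite_dimensional (K : fieldType) (V : lmodType K) : Prop :=
  ~ exists (n : nat) (e : 'I_n -> V),
      forall v : V, exists c : 'I_n -> K, v = \sum_(i < n) c i *: e i.

Section Frames.
Variables (R : realType) (H : completeNormedModType R[i]).
Variable dot : {dot H for conjC}.

(* The norm of a normed space over [R[i]] and the modulus on [R[i]] take their
   values in [R[i]]; these values are real, and [complex.Re] reads them in [R].
   The sum of nonnegative terms is taken in [\bar R], so that the upper bound
   includes its convergence. *)
Definition is_frame (x : int -> H) : Prop :=
  exists A B : R, [/\ 0 < A, A <= B &
    forall u : H,
      ((A * complex.Re `|u| ^+ 2)%:E
         <= \esum_(k in [set: int]) (complex.Re `|dot u (x k)| ^+ 2)%:E)%E /\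
      (\esum_(k in [set: int]) (complex.Re `|dot u (x k)| ^+ 2)%:E
         <= (B * complex.Re `|u| ^+ 2)%:E)%E].

(* [sum] is the norm limit of the net of sums over the finite subsets of the
   index set, i.e. the sum of an unconditionally convergent series. *)
Definition frame_operator (x : int -> H) (u : H) : H :=
  sum (fun k : int => dot u (x k) *: x k).

(* [pinv setT f] is the inverse of [f] whenever [f] is bijective, as is the
   frame operator of a frame. *)
Definition canonical_dual (x : int -> H) (k : int) : H :=
  pinv [set: H] (frame_operator x) (x k).

Definition phase_retrieval (x : int -> H) : Prop :=
  forall u v : H,
    (forall k : int, `|dot u (x k)| = `|dot v (x k)|) ->
    exists alpha : R[i], `|alpha| = 1 /\ u = alpha *: v.

End Frames.

(* Main.v *)
Require Import Defs.
From mathcomp Require Import all_boot all_order all_algebra finmap ring lra.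
From mathcomp Require Import sesquilinear complex.
From mathcomp Require Import all_classical all_reals all_analysis.
From mathcomp.analysis.showcase Require Import summability.
Import Order.TTheory GRing.Theory Num.Theory.
Import numFieldNormedType.Exports.
Local Open Scope classical_set_scope.
Local Open Scope ring_scope.

Set Implicit Arguments.
Unset Strict Implicit.
Unset Printing Implicit Defensive.

(** Let [S] be the frame operator and [d k] the [k]-th canonical dual vector, so
    that [S (d k) = x k]. Since [S] is self-adjoint,
    [<S u, d k> = <u, S (d k)> = <u, x k>]: the moduli measured by the dual
    system on [S u] are those measured by the frame on [u]. As [S] is a linear
    bijection, it transports phase retrieval from one system to the other
    ([phase_retrieval_adjoint]).

    The work lies in showing that [S] really is a self-adjoint linear bijection,
    given only the two frame inequalities.

    - Convergence. The upper bound [B] (Bessel's inequality) says that the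
      coefficient map has norm at most [sqrt B]; by duality so does the
      synthesis map [c |-> sum_k c_k x_k] on finitely supported [c]
      ([synthesis_bound]). Hence the finite partial sums of [S u] form a Cauchy
      net ([frame_series_cvg]).
    - Self-adjointness passes to the limit from the partial sums
      ([frame_operator_selfadjoint]); linearity then follows from the fact that
      an operator with an adjoint is linear.
    - Bijectivity. The quadratic form [<S u, u>] dominates all the partial sums
      of [|<u, x_k>|^2], so it is at least [A |u|^2]; this gives injectivity.
      The bound on the synthesis map gives [|S u|^2 <= B <S u, u>]. Together
      they yield [|u - S u / B|^2 <= (1 - A / B) |u|^2], so for each [y] the map
      [u |-> u - (S u - y) / B] is a contraction, and its fixed point solves
      [S u = y] ([frame_operator_surj]). *)

(** * Real-valued norms *)

Section RealNorm.
Context {R : realType}.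

(** The norm of a normed module over [R[i]] is a nonnegative element of [R[i]];
    reading it in [R] makes it live in a totally ordered field, where the
    decision procedures for ordered fields and suprema are available. *)
Definition rnorm (V : normedZmodType R[i]) (u : V) : R := complex.Re `|u|.

Section Zmod.
Context {V : normedZmodType R[i]}.
Implicit Types u v w : V.

Lemma rnormE u : `|u| = (rnorm u)%:C%C.
Proof. by rewrite /rnorm RRe_real// realE normr_ge0. Qed.

Lemma rnorm_ge0 u : 0 <= rnorm u.
Proof. by rewrite -ler0c -rnormE. Qed.

Lemma rnormD u v : rnorm (u + v) <= rnorm u + rnorm v.
Proof. by rewrite -lecR rmorphD/= -!rnormE ler_normD. Qed.

Lemma rnormN u : rnorm (- u) = rnorm u.
Proof. by rewrite /rnorm normrN. Qed.

Lemma rnorm_distC u v : rnorm (u - v) = rnorm (v - u).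
Proof. by rewrite -opprB rnormN. Qed.

Lemma rnorm_distD w u v : rnorm (u - v) <= rnorm (u - w) + rnorm (w - v).
Proof. by apply: le_trans (rnormD _ _); rewrite addrA subrK. Qed.

Lemma rnorm_eq0 u : rnorm u = 0 -> u = 0.
Proof. by move=> u0; apply/normr0_eq0; rewrite rnormE u0. Qed.

Lemma rnorm_sum (I : Type) (r : seq I) (f : I -> V) :
  rnorm (\sum_(i <- r) f i) <= \sum_(i <- r) rnorm (f i).
Proof.
elim/big_ind2: _ => //.
- by rewrite /rnorm normr0.
- by move=> u a v b ua vb; apply: le_trans (rnormD _ _) _; exact: lerD.
Qed.

End Zmod.

Lemma rnormM (a b : R[i]) : rnorm (a * b) = rnorm a * rnorm b.
Proof. by apply: (@complexI R); rewrite rmorphM/= -!rnormE normrM. Qed.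

Lemma rnormZ (V : normedModType R[i]) (a : R[i]) (u : V) :
  rnorm (a *: u) = rnorm a * rnorm u.
Proof. by apply: (@complexI R); rewrite rmorphM/= -!rnormE normrZ. Qed.

Lemma rnorm_ge_Re (a : R[i]) : complex.Re a <= rnorm a.
Proof.
by rewrite (le_trans (ler_norm _))// -lecR -rnormE; exact: normc_ge_Re.
Qed.

Lemma rnorm_cvg (T : Type) (V : normedModType R[i]) (F : set_system T) {FF : Filter F}
    (f : T -> V) (l : V) :
  (f x @[x --> F] --> l)%classic ->
  forall e : R, 0 < e -> \forall x \near F, rnorm (l - f x) < e.
Proof.
move=> /cvgrPdist_lt fl e e0; have e0' : 0 < e%:C%C by rewrite ltcR.
by apply: filterS (fl _ e0') => x; rewrite rnormE ltcR.
Qed.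

(** Completeness in the form used here: it is enough to exhibit, for each [e], a
    point near which [f] eventually stays. *)
Lemma rnorm_complete (T : Type) (V : completeNormedModType R[i])
    (F : set_system T) {FF : ProperFilter F} (f : T -> V) :
  (forall e : R, 0 < e -> exists l : V, \forall x \near F, rnorm (l - f x) < e) ->
  exists l : V, (f x @[x --> F] --> l)%classic.
Proof.
move=> fC; apply/cvg_ex; apply: cauchy_cvg; apply: cauchy_exP => e e0.
have eE : e = (complex.Re e)%:C%C by rewrite RRe_real// realE ltW.
have [|l lP] := fC (complex.Re e); first by rewrite -ltcR -eE.
exists l; apply: filterS lP => x xl.
by rewrite -ball_normE/= rnormE eE ltcR.
Qed.

End RealNorm.

(** * Fixed points of contractions *)

(** Banach's fixed point theorem over [R[i]], by Picard iteration: all iterates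
    stay within [D / (1 - q)] of the starting point, and shifting both indices
    by [n] contracts distances by [q ^+ n]. *)
Lemma contraction_has_fixpoint (R : realType) (V : completeNormedModType R[i])
    (f : V -> V) (q : R) :
  0 <= q < 1 -> (forall u v, rnorm (f u - f v) <= q * rnorm (u - v)) ->
  exists p, f p = p.
Proof.
move=> /andP[q0 q1] fq.
pose y n := iter n f 0.
pose D := rnorm (y 1%N - y 0%N).
have q1' : 0 < 1 - q by rewrite subr_gt0.
have D0 : 0 <= D by exact: rnorm_ge0.
have bounded m : rnorm (y m - y 0%N) <= D / (1 - q).
  elim: m => [|m IH].
    by rewrite subrr /rnorm normr0 divr_ge0 // ltW.
  apply: le_trans (rnorm_distD (y 1%N) _ _) _.
  have -> : D / (1 - q) = q * (D / (1 - q)) + D by field; rewrite gt_eqF.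
  apply: lerD => //; apply: le_trans (fq _ _) _.
  by rewrite ler_wpM2l.
have dist n m : rnorm (y (m + n)%N - y n) <= q ^+ n * (D / (1 - q)).
  elim: n => [|n IH]; first by rewrite addn0 expr0 mul1r.
  rewrite addnS exprS -mulrA; apply: le_trans (fq _ _) _.
  by rewrite ler_wpM2l.
have small (e : R) : 0 < e ->
    exists N, forall n m, (N <= n)%N -> rnorm (y (m + n)%N - y n) < e.
  move=> e0; have : (geometric (D / (1 - q)) q n @[n --> \oo] --> 0)%classic.
    by apply: cvg_geometric; rewrite ger0_norm.
  move=> /cvgrPdist_lt/(_ _ e0)[N _ NP]; exists N => n m Nn.
  have := NP n Nn; rewrite /= sub0r normrN ger0_norm; last first.
    by rewrite mulr_ge0 ?exprn_ge0// divr_ge0// ltW.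
  by apply: le_lt_trans; rewrite mulrC.
have [|p yp] := @rnorm_complete R nat V \oo _ y.
  move=> e /small[N NP]; exists (y N); exists N => // n /= Nn.
  by rewrite rnorm_distC -(subnK Nn); exact: NP.
exists p; apply/subr0_eq/rnorm_eq0/eqP; rewrite eq_le rnorm_ge0 andbT.
apply/ler_addgt0Pl => e e0; rewrite addr0.
have e20 : 0 < e / 2 by rewrite divr_gt0.
have [N _ NP] := rnorm_cvg yp e20.
apply: le_trans (rnorm_distD (y N.+1) _ _) _.
rewrite [leRHS](splitr e) lerD//.
  apply: le_trans (fq _ _) _.
  apply: le_trans (ltW (NP N (leqnn N))).
  by rewrite ler_piMl ?rnorm_ge0// ltW.
by rewrite rnorm_distC ltW//; exact: NP (leqnSn N).
Qed.

(** * Finite sums *)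

Lemma big_fset_subset (V : nmodType) (I : choiceType) (F0 F : {fset I}) (f : I -> V) :
  (F0 `<=` F)%fset ->
  \sum_(i <- F) f i = \sum_(i <- F0) f i + \sum_(i <- (F `\` F0)%fset) f i.
Proof.
move=> F0F; rewrite (big_fsetID _ (mem F0))/=; congr (_ + _); apply: eq_fbigl => i;
  rewrite !inE/= ?andbT.
  by have [/(fsubsetP F0F)->|] := boolP (i \in F0); rewrite ?andbF.
by rewrite andbC.
Qed.

Lemma partial_sumE (I : choiceType) (V : zmodType) (f : I -> V) (F : {fset I}) :
  partial_sum f F = \sum_(i <- F) f i.
Proof. by rewrite /partial_sum big_seq_fsetE. Qed.

(** * The inner product *)

Section Hilbert.
Variables (R : realType) (H : completeNormedModType R[i]).
Variable dot : {dot H for Num.conj}.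
Hypothesis dot_norm : induces_norm dot.
Implicit Types u v w : H.

Lemma dotE u : dot u u = (rnorm u ^+ 2)%:C%C.
Proof. by rewrite -dot_norm rnormE rmorphXn. Qed.

Lemma dot_conj u v : dot u v = (dot v u)^*.
Proof. by rewrite (hermC dot u v) expr0 mul1r. Qed.

Lemma Re_dotC u v : complex.Re (dot u v) = complex.Re (dot v u).
Proof. by rewrite dot_conj; case: (dot v u). Qed.

Lemma dot_inj u v : (forall w, dot u w = dot v w) -> u = v.
Proof.
move=> uv; apply/subr0_eq/rnorm_eq0/eqP; rewrite -sqrf_eq0; apply/eqP/(@complexI R).
by rewrite -dotE linearBl/= uv subrr.
Qed.

Lemma dotZl a u v : dot (a *: u) v = a * dot u v.
Proof. by rewrite linearZl_LR. Qed.

Lemma dotZr a u v : dot u (a *: v) = a^* * dot u v.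
Proof. by rewrite linearZr_LR. Qed.

Lemma rnormB_sq u v :
  rnorm (u - v) ^+ 2 = rnorm u ^+ 2 + rnorm v ^+ 2 - 2 * complex.Re (dot u v).
Proof.
have normE w : rnorm w ^+ 2 = complex.Re (dot w w) by rewrite dotE.
rewrite !normE dnormB; case: (dot u u) (dot v v) (dot u v) => [a b] [a1 b1] [a2 b2] /=; ring.
Qed.

(** The norm of [|v|^2 u - <u, v> v], which is [|v|^2] times the component of [u]
    orthogonal to [v], is nonnegative; its square is
    [|v|^2 (|v|^2 |u|^2 - |<u, v>|^2)]. *)
Lemma cauchy_schwarz u v : rnorm (dot u v) <= rnorm u * rnorm v.
Proof.
have [v0|v0] := eqVneq (rnorm v) 0.
  by rewrite v0 mulr0 (rnorm_eq0 v0) linear0r /rnorm normr0.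
have vpos : 0 < rnorm v by rewrite lt_def v0 rnorm_ge0.
pose d := dot u v; pose a := rnorm v ^+ 2; pose c := rnorm d ^+ 2.
have apos : 0 < a by rewrite exprn_gt0.
have := sqr_ge0 (rnorm (a%:C%C *: u - d *: v)).
have cross : dot (a%:C%C *: u) (d *: v) = (a * c)%:C%C.
  by rewrite dotZl dotZr mulrC [_ * dot u v]mulrC -normCK rnormE -rmorphXn -rmorphM mulrC.
rewrite rnormB_sq cross !rnormZ.
have -> : rnorm (a%:C%C : R[i]) = a.
  by apply: (@complexI R); rewrite -rnormE ger0_norm// ler0c ltW.
have -> : (a * rnorm u) ^+ 2 + (rnorm d * rnorm v) ^+ 2 - 2 * complex.Re (a * c)%:C%C
  = a * (a * rnorm u ^+ 2 - c) by rewrite /= /a /c; ring.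
rewrite pmulr_rge0// subr_ge0 => cle.
rewrite -(@ler_pXn2r _ 2)// ?nnegrE ?mulr_ge0 ?rnorm_ge0//.
by rewrite exprMn [leRHS]mulrC.
Qed.
End Hilbert.

(** * The frame operator *)

#[local] Existing Instance totally_filter.

Lemma le_of_le_addgt0M (R : realFieldType) (a b k : R) :
  0 <= k -> (forall e, 0 < e -> a <= b + e * k) -> a <= b.
Proof.
move=> k0 ab; apply/ler_addgt0Pr => e e0.
have k1 : 0 < k + 1 by rewrite ltr_wpDl.
apply: le_trans (ab (e / (k + 1)) _) _; first by rewrite divr_gt0.
by rewrite lerD2l -mulrA ler_piMr ?(ltW e0)// mulrC ler_pdivrMr// mul1r lerDl.
Qed.

Section Frame.
Variables (R : realType) (H : completeNormedModType R[i]).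
Variable dot : {dot H for Num.conj}.
Hypothesis dot_norm : induces_norm dot.
Variables (x : int -> H).
Implicit Types (u v w : H) (F : {fset int}).

Definition synthesis F (c : int -> R[i]) : H := \sum_(k <- F) c k *: x k.
Definition energy_on F (c : int -> R[i]) : R := \sum_(k <- F) rnorm (c k) ^+ 2.
Definition coef u (k : int) : R[i] := dot u (x k).

Local Notation S := (frame_operator dot x).

Lemma dot_synthesis F c w :
  dot (synthesis F c) w = \sum_(k <- F) c k * (coef w k)^*.
Proof.
rewrite /synthesis linear_sumlz/=; apply: eq_bigr => k _.
by rewrite dotZl (dot_conj dot (x k)).
Qed.

(** Each partial sum of the frame operator is self-adjoint. *)
Lemma dot_synthesis_coefC F u v :
  dot (synthesis F (coef u)) v = dot u (synthesis F (coef v)).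
Proof.
rewrite [in RHS]dot_conj !dot_synthesis rmorph_sum/=; apply: eq_bigr => k _.
by rewrite rmorphM/= conjCK mulrC.
Qed.

Lemma dot_synthesis_coef F u :
  dot (synthesis F (coef u)) u = (energy_on F (coef u))%:C%C.
Proof.
rewrite dot_synthesis /energy_on rmorph_sum/=; apply: eq_bigr => k _.
by rewrite -normCK rnormE rmorphXn.
Qed.

Lemma energy_on_ge0 F c : 0 <= energy_on F c.
Proof. by apply: sumr_ge0 => k _; exact: sqr_ge0. Qed.

Section Bessel.
Variable B : R.
Hypotheses (B0 : 0 < B)
  (bessel : forall F u, energy_on F (coef u) <= B * rnorm u ^+ 2).

(** Synthesis is adjoint to taking coefficients: with [w = sum c_k x_k] one has
    [|w|^2 = sum c_k <x_k, w>]. The arithmetic-geometric mean inequality,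
    weighted by [B], bounds this by [(B sum |c_k|^2 + |w|^2) / 2], where Bessel's
    inequality has been applied to [w]; then [|w|^2] can be absorbed. *)
Lemma synthesis_bound F c : rnorm (synthesis F c) ^+ 2 <= B * energy_on F c.
Proof.
set w := synthesis F c.
have amgm (a b : R) : a * b <= (B * a ^+ 2 + B^-1 * b ^+ 2) / 2.
  rewrite -subr_ge0.
  have -> : (B * a ^+ 2 + B^-1 * b ^+ 2) / 2 - a * b = (B * a - b) ^+ 2 / (2 * B).
    by field; rewrite gt_eqF.
  by rewrite divr_ge0 ?sqr_ge0// mulr_ge0// ltW.
have : rnorm w ^+ 2 <= (B * energy_on F c + B^-1 * energy_on F (coef w)) / 2.
  have -> : rnorm w ^+ 2 = complex.Re (dot w w) by rewrite dotE.
  apply: le_trans (rnorm_ge_Re _) _.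
  rewrite {1}/w dot_synthesis.
  apply: le_trans (rnorm_sum _ _) _.
  rewrite /energy_on !mulr_sumr -big_split/= mulr_suml; apply: ler_sum => k _.
  apply: le_trans (amgm _ _).
  by rewrite rnormM {2}/rnorm norm_conjC.
have : B^-1 * energy_on F (coef w) <= rnorm w ^+ 2.
  by rewrite mulrC ler_pdivrMr// mulrC.
lra.
Qed.

(** The partial energies [sum_F |<u, x_k>|^2] are bounded, so some finite set [F0]
    comes within [e^2 / B] of their supremum. Any larger [F] then adds energy
    less than [e^2 / B] outside [F0], and by [synthesis_bound] it moves the
    partial sum by less than [e]. *)
Lemma frame_series_cvg u :
  partial_sum (fun k => coef u k *: x k) G @[G --> totally] --> S u.
Proof.
suff [l /cvgP] : exists l : H,
  partial_sum (fun k => coef u k *: x k) G @[G --> totally] --> l by [].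
apply: rnorm_complete => e e0.
pose E := [set energy_on F (coef u) | F in setT].
have supE : has_sup E.
  split; first by exists (energy_on fset0 (coef u)), fset0.
  by exists (B * rnorm u ^+ 2) => _ [F _ <-].
have d0 : 0 < e ^+ 2 / B by rewrite divr_gt0// exprn_gt0.
have [_ [F0 _ <-] F0E] := sup_adherent d0 supE.
exists (synthesis F0 (coef u)); exists F0 => // F /= F0F.
rewrite partial_sumE (big_fset_subset _ F0F)/= -/(synthesis F0 _) -/(synthesis (F `\` F0)%fset _).
rewrite rnorm_distC [X in X - _]addrC addrK.
rewrite -(@ltr_pXn2r _ 2)// ?nnegrE ?rnorm_ge0 ?(ltW e0)//.
apply: le_lt_trans (synthesis_bound _ _) _.
have FE : energy_on F (coef u) <= sup E by apply: ub_le_sup; [exact: supE.2|exists F].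
move: FE; rewrite /energy_on (big_fset_subset _ F0F)/= -!/(energy_on _ _) => FE.
by rewrite mulrC -ltr_pdivlMr//; move: F0E FE; lra.
Qed.

(** Two vectors are approximated along a common finite set, as the comparison of
    [<S u, v>] with [<u, S v>] requires. *)
Lemma frame_operator_approx u v F0 (e : R) : 0 < e ->
  exists F, [/\ (F0 `<=` F)%fset, rnorm (S u - synthesis F (coef u)) < e &
    rnorm (S v - synthesis F (coef v)) < e].
Proof.
move=> e0.
have F0F : \forall F \near totally, (F0 `<=` F)%fset by exists F0.
have [F [? []]] := filter_ex (filterI F0F
  (filterI (rnorm_cvg (@frame_series_cvg u) e0) (rnorm_cvg (@frame_series_cvg v) e0))).
by rewrite !partial_sumE; exists F; split.
Qed.

Lemma frame_operator_selfadjoint u v : dot (S u) v = dot u (S v).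
Proof.
apply/subr0_eq/rnorm_eq0/eqP; rewrite eq_le rnorm_ge0 andbT.
apply: (@le_of_le_addgt0M _ _ _ (rnorm v + rnorm u)); first by rewrite addr_ge0 ?rnorm_ge0.
move=> e e0; rewrite add0r.
have [F [_ Fu Fv]] := frame_operator_approx u v fset0 e0.
apply: le_trans (rnorm_distD (dot (synthesis F (coef u)) v) _ _) _.
rewrite {2}dot_synthesis_coefC -linearBl/= -linearBr/= mulrDr lerD//.
  by apply: le_trans (cauchy_schwarz dot_norm _ _) _; rewrite ler_wpM2r ?rnorm_ge0// ltW.
apply: le_trans (cauchy_schwarz dot_norm _ _) _.
by rewrite mulrC rnorm_distC ler_wpM2r ?rnorm_ge0// ltW.
Qed.

(** Additivity and homogeneity can be tested against an arbitrary [w], where [S]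
    moves to the other side. *)
Lemma frame_operatorB u v : S (u - v) = S u - S v.
Proof.
apply: (dot_inj dot_norm) => w.
by rewrite linearBl/= !frame_operator_selfadjoint linearBl.
Qed.

Lemma frame_operatorZ (a : R[i]) u : S (a *: u) = a *: S u.
Proof.
apply: (dot_inj dot_norm) => w.
by rewrite dotZl !frame_operator_selfadjoint dotZl.
Qed.

(** The quadratic form of the frame operator; the real part discards a zero
    imaginary part. *)
Definition energy u : R := complex.Re (dot (S u) u).

(** The partial energies increase to [<S u, u>], since
    [<sum_(k in F) <u, x_k> x_k, u>] is the energy on [F]. *)
Lemma energy_on_le F u : energy_on F (coef u) <= energy u.
Proof.
apply: (@le_of_le_addgt0M _ _ _ (rnorm u)); first exact: rnorm_ge0.
move=> e e0; have [G [FG Gu _]] := frame_operator_approx u u F e0.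
apply: (@le_trans _ _ (energy_on G (coef u))).
  rewrite /energy_on (big_fset_subset _ FG)/= lerDl.
  by apply: sumr_ge0 => k _; exact: sqr_ge0.
have -> : energy_on G (coef u) =
    energy u + complex.Re (dot (synthesis G (coef u) - S u) u).
  by rewrite linearBl/= raddfB/= dot_synthesis_coef /= addrC subrK.
rewrite lerD2l; apply: le_trans (rnorm_ge_Re _) _.
apply: le_trans (cauchy_schwarz dot_norm _ _) _.
by rewrite rnorm_distC ler_wpM2r ?rnorm_ge0// ltW.
Qed.

(** This is [S^2 <= B S]. It is sharper than [|S u| <= B |u|] and gives the
    contraction below without an operator norm for self-adjoint maps. *)
Lemma rnorm_frame_operator_sq u : rnorm (S u) ^+ 2 <= B * energy u.
Proof.
have E0 : 0 <= energy u by exact: le_trans (energy_on_ge0 _ _) (energy_on_le fset0 u).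
have BE0 : 0 <= B * energy u by rewrite mulr_ge0// ltW.
rewrite -[leRHS]sqr_sqrtr// ler_pXn2r ?nnegrE ?rnorm_ge0 ?sqrtr_ge0//.
apply: (@le_of_le_addgt0M _ _ _ 1) => // e e0; rewrite mulr1.
have [F [_ Fu _]] := frame_operator_approx u u fset0 e0.
rewrite -[S u](subrK (synthesis F (coef u))) addrC.
apply: le_trans (rnormD _ _) _; apply: lerD (ltW Fu).
rewrite -(@ler_pXn2r _ 2)// ?nnegrE ?rnorm_ge0 ?sqrtr_ge0// sqr_sqrtr//.
apply: le_trans (synthesis_bound _ _) _.
by rewrite ler_pM2l// energy_on_le.
Qed.

Section Bijective.
Variable A : R.
Hypotheses (A0 : 0 < A) (AB : A <= B) (coercive : forall u, A * rnorm u ^+ 2 <= energy u).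

Lemma frame_operator_inj : injective S.
Proof.
move=> u v Suv; apply/subr0_eq/rnorm_eq0/eqP; rewrite -sqrf_eq0 eq_le sqr_ge0 andbT.
have := coercive (u - v).
by rewrite /energy frame_operatorB Suv subrr linear0l pmulr_rle0.
Qed.

(** With [w = u - v], the map [f] below satisfies
    [|f u - f v|^2 = |w|^2 - 2 <S w, w> / B + |S w|^2 / B^2
       <= |w|^2 - <S w, w> / B <= (1 - A / B) |w|^2]. *)
Lemma frame_operator_surj y : exists u, S u = y.
Proof.
pose t : R[i] := (B^-1)%:C%C.
have t0 : t != 0 by rewrite eq_complex/= eqxx andbT invr_neq0// gt_eqF.
pose q := 1 - A / B.
have q0 : 0 <= q by rewrite subr_ge0 ler_pdivrMr// mul1r.
have q1 : Num.sqrt q < 1.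
  by rewrite -sqrtr1 ltr_sqrt// /q gtrBl divr_gt0.
pose f u := u - t *: (S u - y).
have [||u fu] := @contraction_has_fixpoint R H f (Num.sqrt q).
- by rewrite sqrtr_ge0.
- move=> u v; set w := u - v.
  have -> : f u - f v = w - t *: S w.
    rewrite /f /w frame_operatorB opprD addrACA -opprD -scalerBr.
    by rewrite [- (S v - y)]opprD addrACA subrr addr0.
  rewrite -(@ler_pXn2r _ 2)// ?nnegrE ?mulr_ge0 ?rnorm_ge0 ?sqrtr_ge0//.
  rewrite exprMn sqr_sqrtr// (rnormB_sq dot_norm) Re_dotC dotZl rnormZ.
  have -> : rnorm t = B^-1.
    by apply: (@complexI R); rewrite -rnormE ger0_norm// ler0c invr_ge0 ltW.
  have -> : complex.Re (t * dot (S w) w) = B^-1 * energy w.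
    by rewrite /energy /t; case: (dot _ _) => a b /=; rewrite mul0r subr0.
  have Sw := rnorm_frame_operator_sq w.
  have lower : A / B * rnorm w ^+ 2 <= B^-1 * energy w.
    by rewrite mulrAC mulrC ler_pM2l ?invr_gt0.
  have upper : (B^-1 * rnorm (S w)) ^+ 2 <= B^-1 * energy w.
    have -> : B^-1 * energy w = B^-1 ^+ 2 * (B * energy w).
      by field; rewrite gt_eqF.
    by rewrite exprMn ler_pM2l// exprn_gt0 ?invr_gt0.
  rewrite /q; lra.
- exists u; apply/subr0_eq/eqP.
  have /eqP : t *: (S u - y) = 0 by apply: oppr_inj; apply: (addrI u); rewrite oppr0 addr0.
  by rewrite scaler_eq0 (negPf t0).
Qed.
End Bijective.
End Bessel.
End Frame.

(** * From the frame inequalities to phase retrieval *)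

Section FrameBounds.
Variables (R : realType) (H : completeNormedModType R[i]).
Variable dot : {dot H for Num.conj}.
Variable x : int -> H.

Lemma energy_on_esum (F : {fset int}) u :
  ((energy_on F (coef dot x u))%:E
    <= \esum_(k in [set: int]) (complex.Re `|dot u (x k)| ^+ 2)%:E)%E.
Proof.
apply: esum_ge; exists [set` F]; first by split => //; exact: finite_fset.
by rewrite fsbig_finite ?set_fsetK; [rewrite sumEFin | exact: finite_fset].
Qed.

Lemma esum_le_energy (c : R) u :
  (forall F : {fset int}, energy_on F (coef dot x u) <= c) ->
  (\esum_(k in [set: int]) (complex.Re `|dot u (x k)| ^+ 2)%:E <= c%:E)%E.
Proof.
move=> Fc; apply: ge_ereal_sup => _ [X [finX _] <-].
by rewrite fsbig_finite// sumEFin lee_fin; exact: Fc.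
Qed.
End FrameBounds.

(** [S] carries the phaseless measurements by [x] to those by [d], and, being
    homogeneous and bijective, it preserves and reflects equality up to phase. *)
Lemma phase_retrieval_adjoint (R : realType) (H : completeNormedModType R[i])
    (dot : {dot H for Num.conj}) (S : H -> H) (x d : int -> H) :
  (forall a u, S (a *: u) = a *: S u) -> injective S -> (forall y, exists u, S u = y) ->
  (forall u k, dot (S u) (d k) = dot u (x k)) ->
  phase_retrieval dot d <-> phase_retrieval dot x.
Proof.
move=> SZ Sinj Ssurj dotS; split => pr u v uv.
- have [|a [a1 Suv]] := pr (S u) (S v); first by move=> k; rewrite !dotS.
  by exists a; split => //; apply: Sinj; rewrite SZ.
- have [u' Su] := Ssurj u; have [v' Sv] := Ssurj v.
  have [|a [a1 uv']] := pr u' v'; first by move=> k; rewrite -!dotS Su Sv.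
  by exists a; split => //; rewrite -Su -Sv uv' SZ.
Qed.

Theorem corollary3p2 (R : realType) (H : completeNormedModType R[i])
    (dot : {dot H for Num.conj})
    (dot_norm : induces_norm dot)
    (Hsep : separable_space H)
    (Hinf : infinite_dimensional H)
    (x : int -> H) (x_frame : is_frame dot x) :
  phase_retrieval dot (canonical_dual dot x) <-> phase_retrieval dot x.
Proof.
have [A [B [A0 AB frameAB]]] := x_frame.
have B0 : 0 < B by exact: lt_le_trans AB.
have bessel F u : energy_on F (coef dot x u) <= B * rnorm u ^+ 2.
  rewrite -lee_fin; apply: le_trans (frameAB u).2.
  exact: energy_on_esum.
have coercive u : A * rnorm u ^+ 2 <= energy dot x u.
  rewrite -lee_fin; apply: le_trans (frameAB u).1 _.
  by apply: esum_le_energy => F; exact: (energy_on_le dot_norm B0 bessel).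
have surj := frame_operator_surj dot_norm B0 bessel A0 AB coercive.
apply: (@phase_retrieval_adjoint _ _ _ (frame_operator dot x)).
- exact: (frame_operatorZ dot_norm B0 bessel).
- exact: (frame_operator_inj dot_norm B0 bessel A0 coercive).
- exact: surj.
- (* the surjectivity of [S] makes its pseudo-inverse a right inverse *)
  move=> u k; rewrite (frame_operator_selfadjoint dot_norm B0 bessel).
  rewrite /canonical_dual (@surjpK _ _ _ setT setT) ?in_setT// => y _.
  by have [w <-] := surj y; exists w.
Qed.
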